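(* Let $n\ge1$, $T>0$, and let $u_0:\mathbb{R}^n\to\mathbb{R}$ be a convex function defining a proper entire graph, i.e. $u_0(x)\to+\infty$ as $|x|\to+\infty$. Let $u_1,u_2:\mathbb{R}^n\times(0,T)\to\mathbb{R}$ be two smooth solutions of $$u_t=\sum_{i,j=1}^n\Big(\delta^{ij}-\frac{D_iu\,D_ju}{1+|Du|^2}\Big)D_{ij}u\qquad\text{on }\mathbb{R}^n\times(0,T)$$ such that for each $t\in(0,T)$ and $i=1,2$ the graph $M^i_t=\{(x,u_i(x,t)):x\in\mathbb{R}^n\}$ is a proper convex entire graph, with the same initial data $u_0$, that is, $\lim_{t\to0}u_1(\cdot,t)=\lim_{t\to0}u_2(\cdot,t)=u_0$. Then $u_1=u_2$ on $\mathbb{R}^n\times(0,T)$, that is, $M^1_t=M^2_t$ for all $t\in(0,T)$.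
   Context: The graph of a function $u:\mathbb{R}^n\to\mathbb{R}$ is called a proper entire graph if $u(x)\to+\infty$ as $|x|\to+\infty$; it is a convex entire graph if $u$ is a convex function. The limits $\lim_{t\to0}u_i(\cdot,t)=u_0$ are understood as uniform convergence on compact subsets of $\mathbb{R}^n$. *)

(* Defs.v *)
From HB Require Import structures.
From mathcomp Require Import all_boot all_order all_algebra.
From mathcomp Require Import all_classical all_reals all_analysis.

Set Implicit Arguments.
Unset Strict Implicit.
Unset Printing Implicit Defensive.

Import Order.TTheory GRing.Theory Num.Theory.
Import numFieldNormedType.Exports.

Local Open Scope classical_set_scope.
Local Open Scope ring_scope.

(* The norm of ['rV[R]_n] is the sup norm; being equivalent to the Euclidean
   one, it gives the same meaning to |x| -> +oo. *)
Definition proper_entire_graph (R : realType) (n : nat)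
    (u : 'rV[R]_n -> R) : Prop :=
  forall A : R, exists r : R, forall x : 'rV[R]_n, r <= `|x| -> A <= u x.

Definition convex_entire_graph (R : realType) (n : nat)
    (u : 'rV[R]_n -> R) : Prop :=
  convex_function [set: convex_lmodType 'rV[R]_n] u.

Definition graph (R : realType) (n : nat) (u : 'rV[R]_n -> R) :
    set ('rV[R]_n * R) := [set p | p.2 = u p.1].

(* [Ck_on k U f]: on the open set [U] all iterated directional derivatives of
   [f] of order at most [k] exist and are continuous.  ['D_v f] at a point of
   [U] only depends on [f] near that point, so the values of [f] outside [U]
   are irrelevant. *)
Fixpoint Ck_on (R : realType) (V : normedModType R) (k : nat) (U : set V)
    (f : V -> R) {struct k} : Prop :=
  (forall x, U x -> {for x, continuous f}) /\
  match k with
  | 0%N => True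
  | k'.+1 => forall v : V,
      (forall x, U x -> derivable f x v) /\ Ck_on k' U ('D_v f)
  end.

Definition smooth_on (R : realType) (V : normedModType R) (U : set V)
    (f : V -> R) : Prop := forall k, Ck_on k U f.

Definition pderiv (R : realType) (n : nat) (i : 'I_n) (f : 'rV[R]_n -> R) :
    'rV[R]_n -> R := 'D_(delta_mx 0 i) f.

(* The sum of squares is the Euclidean |Du|^2, not the library norm. *)
Definition sqr_norm_grad (R : realType) (n : nat) (f : 'rV[R]_n -> R)
    (x : 'rV[R]_n) : R := \sum_(i < n) (pderiv i f x) ^+ 2.

Definition graphical_mcf_operator (R : realType) (n : nat)
    (f : 'rV[R]_n -> R) (x : 'rV[R]_n) : R :=
  \sum_(i < n) \sum_(j < n)
    ((i == j)%:R - pderiv i f x * pderiv j f x / (1 + sqr_norm_grad f x))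
    * pderiv i (pderiv j f) x.

(* [u x t] is u(x,t); only its values for 0 < t < T matter. *)
Definition smooth_graphical_mcf (R : realType) (n : nat) (T : R)
    (u : 'rV[R]_n -> R -> R) : Prop :=
  smooth_on ([set p | 0 < p.2 < T] : set ('rV[R]_n * R)%type)
    (fun p => u p.1 p.2) /\
  forall (x : 'rV[R]_n) (t : R), 0 < t < T ->
    derive1 (u x) t = graphical_mcf_operator (u ^~ t) x.

Definition has_initial_data (R : realType) (n : nat)
    (u : 'rV[R]_n -> R -> R) (u0 : 'rV[R]_n -> R) : Prop :=
  {family compact, (fun t : R => u ^~ t) @ 0^'+ --> u0}.

(* Main.v *)
Require Import Defs.
From HB Require Import structures.
From mathcomp Require Import all_boot all_order all_algebra.
From mathcomp Require Import all_classical all_reals all_analysis.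
From mathcomp Require Import ring lra.

Set Implicit Arguments.
Unset Strict Implicit.
Unset Printing Implicit Defensive.

Import Order.TTheory GRing.Theory Num.Theory.
Import numFieldNormedType.Exports.

Local Open Scope classical_set_scope.
Local Open Scope ring_scope.

(** By symmetry it is enough to prove u1 <= u2.  For 0 < mu < 1 compare u2 with
    the contraction v(x, t) = u1(mu x, mu^2 t).  Write a(p) for the matrix
    I - p p^T / (1 + |p|^2) and a(p) : H for the trace of a(p) H, so that the
    equation reads u_t = a(Du) : D^2 u.

    Contracting the domain without contracting the height turns the solution u1
    into a subsolution: Dv = mu Du1 and v_t = a(Du1) : D^2 v, and since D^2 v is
    nonnegative, a(Du1) : D^2 v <= a(mu Du1) : D^2 v (mcf_trace_flatten).

    The gain is that v - u2 tends to -oo at infinity, uniformly in time, so that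
    the maximum principle applies although the domain is unbounded.  Indeed a
    shrinking barrier bounds u1(z, t) by the supremum of u0 over a ball of fixed
    radius rho about z, plus a constant (mcf_barrier).  Every point of the ball
    of radius rho about mu x is a convex combination, with weights mu and
    1 - mu, of x and a point of norm at most rho / (1 - mu); hence convexity of
    u0 gives v <= mu u0 + C (contracted_upper_bound).  On the other hand
    u2 >= u0, because convex solutions increase in time
    (convex_mcf_ge_initial).  Thus v - u2 <= C - (1 - mu) u0, and u0 is proper.

    Initially v - u2 = u0(mu x) - u0(x) <= (1 - mu) (u0(0) - inf u0), again by
    convexity.  The maximum principle keeps this bound for all times
    (contracted_comparison), and mu -> 1 gives u1 <= u2 (mcf_le).

    Both uses of the maximum principle go through the first time at which a
    continuous function of space and time reaches a level
    (first_touching_time).  At such a point derivatives are only tested along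
    straight lines, so second_jet records the first and second derivatives of
    all restrictions to lines through a point. *)

(** * The second-order operator as a function of gradient and Hessian *)

Section Symbol.
Context {R : realType} {n : nat}.
Implicit Types (p v x : 'rV[R]_n) (H : 'M[R]_n).

Definition dot p v : R := \sum_i p 0 i * v 0 i.

Definition qform H v : R := \sum_i \sum_j v 0 i * v 0 j * H i j.

(** The trace of a(p) H; graphical_mcf_operator is its value at the gradient
    and the Hessian. *)
Definition mcf_trace p H : R :=
  \sum_i \sum_j ((i == j)%:R - p 0 i * p 0 j / (1 + dot p p)) * H i j.

Lemma dot_ge0 p : 0 <= dot p p.
Proof. by apply: sumr_ge0 => i _; rewrite -expr2 sqr_ge0. Qed.

Lemma dotC p v : dot p v = dot v p.
Proof. by apply: eq_bigr => i _; rewrite mulrC. Qed.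

Lemma dotZl c p v : dot (c *: p) v = c * dot p v.
Proof. by rewrite /dot mulr_sumr; apply: eq_bigr => i _; rewrite mxE mulrA. Qed.

Lemma dotZr c p v : dot p (c *: v) = c * dot p v.
Proof. by rewrite dotC dotZl dotC. Qed.

Lemma dotDl p v x : dot (p + v) x = dot p x + dot v x.
Proof. by rewrite /dot -big_split; apply: eq_bigr => i _; rewrite mxE mulrDl. Qed.

Lemma dotDr p v x : dot x (p + v) = dot x p + dot x v.
Proof. by rewrite dotC dotDl !(dotC x). Qed.

Lemma dot_delta p i : dot p (delta_mx 0 i) = p 0 i.
Proof.
rewrite /dot (bigD1 i) //= mxE !eqxx mulr1 big1 ?addr0 // => j ji.
by rewrite mxE (negbTE ji) andbF mulr0.
Qed.

Lemma dot_inj p v : (forall x, dot p x = dot v x) -> p = v.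
Proof. by move=> pv; apply/rowP => i; rewrite -!dot_delta. Qed.

Lemma mcf_traceE p H : mcf_trace p H = \tr H - qform H p / (1 + dot p p).
Proof.
rewrite /mcf_trace /mxtrace /qform mulr_suml -sumrB; apply: eq_bigr => i _.
have -> : H i i = \sum_j (i == j)%:R * H i j.
  rewrite (bigD1 i) //= eqxx mul1r big1 ?addr0 // => j.
  by rewrite eq_sym => /negbTE ->; rewrite mul0r.
rewrite mulr_suml -sumrB; apply: eq_bigr => j _; ring.
Qed.

Lemma qformB H K v : qform (H - K) v = qform H v - qform K v.
Proof.
rewrite /qform -sumrB; apply: eq_bigr => i _; rewrite -sumrB.
by apply: eq_bigr => j _; rewrite !mxE mulrBr.
Qed.

Lemma qformZ c H v : qform (c *: H) v = c * qform H v.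
Proof.
rewrite /qform mulr_sumr; apply: eq_bigr => i _; rewrite mulr_sumr.
by apply: eq_bigr => j _; rewrite !mxE; ring.
Qed.

Lemma qformZv c H v : qform H (c *: v) = c ^+ 2 * qform H v.
Proof.
rewrite /qform mulr_sumr; apply: eq_bigr => i _; rewrite mulr_sumr.
by apply: eq_bigr => j _; rewrite !mxE; ring.
Qed.

Lemma mcf_traceB p H K : mcf_trace p (H - K) = mcf_trace p H - mcf_trace p K.
Proof. rewrite !mcf_traceE qformB raddfB /=; ring. Qed.

Lemma mcf_traceZ c p H : mcf_trace p (c *: H) = c * mcf_trace p H.
Proof. rewrite !mcf_traceE qformZ mxtraceZ; ring. Qed.

Lemma qform_delta H i : qform H (delta_mx 0 i) = H i i.
Proof.
rewrite /qform (bigD1 i) //= (bigD1 i) //= !mxE !eqxx !mul1r !big1 ?addr0 //.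
  by move=> j ji; rewrite big1 // => k _; rewrite mxE (negbTE ji) andbF !mul0r.
by move=> j ji; rewrite !mxE (negbTE ji) andbF mulr0 mul0r.
Qed.

Lemma sum_delta (F : 'I_n -> R) i : \sum_k (k == i)%:R * F k = F i.
Proof.
rewrite (bigD1 i) //= eqxx mul1r big1 ?addr0 // => j /negbTE ->.
by rewrite mul0r.
Qed.

Lemma qform_plane H (a b : R) i j :
  qform H (a *: delta_mx 0 j - b *: delta_mx 0 i) =
  a ^+ 2 * H j j + b ^+ 2 * H i i - a * b * (H i j + H j i).
Proof.
rewrite /qform.
transitivity (\sum_k \sum_l
    (a * (k == j)%:R - b * (k == i)%:R) * (a * (l == j)%:R - b * (l == i)%:R) * H k l).
  by apply: eq_bigr => k _; apply: eq_bigr => l _; rewrite !mxE.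
have E k : \sum_l (a * (k == j)%:R - b * (k == i)%:R) *
     (a * (l == j)%:R - b * (l == i)%:R) * H k l =
     (k == j)%:R * (a * (a * H k j - b * H k i))
     - (k == i)%:R * (b * (a * H k j - b * H k i)).
  rewrite -(sum_delta (H k) j) -(sum_delta (H k) i) !mulr_sumr -!sumrB.
  rewrite !mulr_sumr -sumrB; apply: eq_bigr => l _; ring.
under eq_bigr do rewrite E.
by rewrite sumrB !sum_delta; ring.
Qed.

(** Multiplied by 1 + |p|^2, the trace is tr H plus half the sum over i and j of
    the values of H at the vectors p_i e_j - p_j e_i.  This is Lagrange's
    identity and avoids taking a square root of a(p). *)
Lemma mcf_trace_ge0 p H : (forall v, 0 <= qform H v) -> 0 <= mcf_trace p H.
Proof.
move=> H0; have trH : 0 <= \tr H.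
  by apply: sumr_ge0 => i _; rewrite -qform_delta.
have : 0 <= \sum_i \sum_j
    qform H (p 0 i *: delta_mx 0 j - p 0 j *: delta_mx 0 i).
  by apply: sumr_ge0 => i _; apply: sumr_ge0.
have -> : \sum_i \sum_j qform H (p 0 i *: delta_mx 0 j - p 0 j *: delta_mx 0 i)
    = 2 * (dot p p * \tr H - qform H p).
  under eq_bigr do under eq_bigr do rewrite qform_plane.
  have E1 : \sum_i \sum_j p 0 i ^+ 2 * H j j = dot p p * \tr H.
    rewrite mulr_suml; apply: eq_bigr => i _; rewrite mulr_sumr.
    by apply: eq_bigr => j _; rewrite expr2.
  have E2 : \sum_i \sum_j p 0 j ^+ 2 * H i i = dot p p * \tr H.
    by rewrite -E1 exchange_big.
  have E3 : \sum_i \sum_j p 0 i * p 0 j * H j i = qform H p.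
    rewrite /qform exchange_big; apply: eq_bigr => i _; apply: eq_bigr => j _; ring.
  have -> : 2 * (dot p p * \tr H - qform H p)
     = (dot p p * \tr H + dot p p * \tr H) - (qform H p + qform H p) by ring.
  rewrite -{1}E1 -{1}E2 -{2}E3 /qform -!big_split -sumrB; apply: eq_bigr => i _ /=.
  rewrite -!big_split -sumrB; apply: eq_bigr => j _ /=; ring.
move=> h; rewrite mcf_traceE subr_ge0.
have p0 := dot_ge0 p.
by rewrite ler_pdivrMr; nra.
Qed.

Lemma mcf_trace_mono p H K :
  (forall v, qform H v <= qform K v) -> mcf_trace p H <= mcf_trace p K.
Proof.
by move=> HK; rewrite -subr_ge0 -mcf_traceB mcf_trace_ge0 // => v;
  rewrite qformB subr_ge0.
Qed.

(** Shrinking p by a factor mu replaces the weight 1 / (1 + |p|^2) of H(p, p) in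
    a(p) : H by the smaller one mu^2 / (1 + mu^2 |p|^2). *)
Lemma mcf_trace_flatten mu p H : 0 <= mu <= 1 -> 0 <= qform H p ->
  mcf_trace p H <= mcf_trace (mu *: p) H.
Proof.
move=> /andP[m0 m1] Hp; rewrite !mcf_traceE lerD2l lerN2 qformZv dotZl dotZr.
have p0 := dot_ge0 p.
have m2 : mu ^+ 2 <= 1 by rewrite expr_le1.
have m20 : 0 <= mu ^+ 2 by rewrite sqr_ge0.
rewrite [_ * qform _ _]mulrC -mulrA ler_wpM2l //.
have D : 0 < 1 + mu * (mu * dot p p) by rewrite ltr_pwDl // !mulr_ge0.
rewrite ler_pdivrMr // mulrC ler_pdivlMr; last by lra.
by rewrite mulrDr mulr1 expr2 -mulrA lerD2r -expr2.
Qed.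

(** This matrix, a x x^T + b I, is what the Hessian of a radial barrier looks
    like. *)
Definition rank1_plus_scalar (a b : R) x : 'M[R]_n :=
  \matrix_(i, j) (a * (x 0 i * x 0 j) + b * (i == j)%:R).

Lemma qform_rank1_plus_scalar a b x v :
  qform (rank1_plus_scalar a b x) v = a * dot x v ^+ 2 + b * dot v v.
Proof.
have -> : a * dot x v ^+ 2 + b * dot v v =
    \sum_i v 0 i * (a * x 0 i * dot x v + b * v 0 i).
  under eq_bigr do rewrite mulrDr.
  rewrite big_split /= expr2 {1}/dot mulr_suml mulr_sumr [dot v v]/dot mulr_sumr.
  by congr (_ + _); apply: eq_bigr => i _; ring.
apply: eq_bigr => i _; rewrite -[X in b * X](sum_delta (v 0) i) /dot.
rewrite !mulr_sumr -big_split mulr_sumr /=.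
by apply: eq_bigr => j _; rewrite !mxE (eq_sym j); ring.
Qed.

(** In the direction of the gradient k x the operator damps second derivatives
    by 1 + k^2 |x|^2, so the rank one term contributes at most a / k^2,
    independently of |x|. *)
Lemma mcf_trace_rank1_plus_scalar a b k x : 0 <= a -> 0 <= b -> 0 < k ->
  mcf_trace (k *: x) (rank1_plus_scalar a b x) <= a / k ^+ 2 + b * n%:R.
Proof.
move=> a0 b0 k0; rewrite mcf_traceE qform_rank1_plus_scalar !dotZl !dotZr.
have -> : \tr (rank1_plus_scalar a b x) = a * dot x x + b * n%:R.
  rewrite /mxtrace; under eq_bigr do rewrite !mxE eqxx mulr1.
  by rewrite big_split /= -mulr_sumr sumr_const card_ord mulr_natr.
set X := dot x x; have X0 : 0 <= X by exact: dot_ge0.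
have Y0 : 0 <= k * (k * X) by rewrite !mulr_ge0 // ltW.
have D : 0 < 1 + k * (k * X) by lra.
rewrite addrAC lerD2r lerBlDr -subr_ge0.
have -> : a / k ^+ 2 + (a * (k * X) ^+ 2 + b * (k * (k * X))) / (1 + k * (k * X))
     - a * X = (a / k ^+ 2 + b * (k * (k * X))) / (1 + k * (k * X)).
  field; rewrite !gt_eqF //=; nra.
by rewrite divr_ge0 ?addr_ge0 ?mulr_ge0 ?invr_ge0 ?exprn_ge0 // ltW.
Qed.

End Symbol.

(** * Derivative tests in one variable and directional derivatives *)

Section OneVariable.
Context {R : realType}.
Implicit Types (f df : R -> R) (x d c e : R).

Lemma is_derive_eps f x d : is_derive x (1:R) f d -> forall e, 0 < e ->
  exists2 r, 0 < r & forall h, h != 0 -> `|h| < r ->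
    `|h^-1 * (f (x + h) - f x) - d| < e.
Proof.
move=> [fx <-] e e0; move: fx; rewrite /derivable => /cvgrPdist_lt/(_ e e0).
rewrite near_withinE => -[r /= r0 H]; exists r => // h h0 hr.
have := H h; rewrite /= sub0r normrN => /(_ hr h0).
by rewrite distrC /= [h *: 1]mulr1 [h + x]addrC.
Qed.

Lemma derive_local_max0 f df : (forall s, is_derive s (1:R) f (df s)) ->
  (\forall s \near 0, f s <= f 0) -> df 0 = 0.
Proof.
move=> fd [r /= r0 H].
have [||||_ E] := @derive1_at_max _ f (- r) r 0; first by lra.
- by move=> t _.
- by rewrite in_itv /=; lra.
- move=> t; rewrite in_itv /= => tr; apply: H; rewrite /= sub0r normrN ltr_norml; lra.
- by have [_ <-] := fd 0.
Qed.

Lemma derive_past_max_ge0 f x d : 0 < x -> is_derive x (1:R) f d ->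
  (forall s, 0 < s < x -> f s <= f x) -> 0 <= d.
Proof.
move=> x0 fd fx; rewrite leNgt; apply/negP => d0.
have [|r r0 H] := is_derive_eps fd (e := - d); first by lra.
pose h := Num.min (r / 2) (x / 2).
have h0 : 0 < h by rewrite lt_min; apply/andP; split; lra.
have hr : h < r by rewrite gt_min; apply/orP; left; lra.
have hx : h < x by rewrite gt_min; apply/orP; right; lra.
have := H (- h); rewrite oppr_eq0 gt_eqF // normrN gtr0_norm // => /(_ isT hr).
rewrite ltr_norml => /andP[_]; rewrite ltrBlDr addNr invrN mulNr oppr_lt0.
have : f (x - h) <= f x by apply: fx; lra.
rewrite -subr_le0 => fh; rewrite pmulr_rgt0 ?invr_gt0 //; lra.
Qed.

Lemma derive_ge0_le f df (a b : R) :
  (forall s, a <= s <= b -> is_derive s (1:R) f (df s)) ->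
  (forall s, a <= s <= b -> 0 <= df s) -> a <= b -> f a <= f b.
Proof.
move=> fd df0 ab.
have [s|| c] := @MVT_segment R f df a b ab.
- by rewrite in_itv /= => /andP[sa sb]; apply: fd; rewrite !ltW.
- apply: derivable_within_continuous => s; rewrite in_itv /= => sab.
  by have [] := fd s sab.
- rewrite in_itv /= => cab E; rewrite -subr_ge0 E mulr_ge0 ?subr_ge0 //.
  exact: df0.
Qed.

(** Symmetric second differences control the second derivative; this one test
    serves both local maxima and concavity. *)
Lemma second_derivative_le0 f df c : (forall s, is_derive s (1:R) f (df s)) ->
  is_derive (0:R) (1:R) df c -> (\forall s \near 0, f s + f (- s) <= 2 * f 0) -> c <= 0.
Proof.
move=> fd dfc [r /= r0 H]; rewrite leNgt; apply/negP => c0.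
have [k k0 K] := is_derive_eps dfc c0.
pose b := Num.min (r / 2) (k / 2).
have b0 : 0 < b by rewrite lt_min; apply/andP; split; lra.
have br : b < r by rewrite gt_min; apply/orP; left; lra.
have bk : b < k by rewrite gt_min; apply/orP; right; lra.
have fdN s : is_derive s (1:R) (fun s => f (- s)) (- df (- s)).
  have := @is_derive1_comp R f -%R s (df (- s)) (-1) (fd _) _.
  rewrite mulrN1; apply.
have gd s : is_derive s (1:R) (fun s => f s + f (- s)) (df s - df (- s)).
  exact: is_deriveD.
have [|q] := @MVT R (fun s => f s + f (- s)) (fun s => df s - df (- s)) 0 b b0.
- by apply: derivable_within_continuous => s _; have [] := gd s.
rewrite in_itv /= => /andP[q0 qb] E.
have qk : q < k by exact: lt_trans bk.
have := K q; rewrite gt_eqF // gtr0_norm // => /(_ isT qk).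
have := K (- q); rewrite oppr_eq0 gt_eqF // normrN gtr0_norm // => /(_ isT qk).
rewrite !ltr_norml !add0r invrN mulNr => /andP[h1 _] /andP[h2 _].
have h1' : 0 < - (q^-1 * (df (- q) - df 0)) by lra.
have h2' : 0 < q^-1 * (df q - df 0) by lra.
rewrite -mulrN !pmulr_rgt0 ?invr_gt0 // in h1' h2'.
have : 0 < (df q - df (- q)) * (b - 0) by rewrite mulr_gt0 //; lra.
rewrite -E oppr0.
have := H b; rewrite /= sub0r normrN gtr0_norm // => /(_ br); lra.
Qed.

End OneVariable.

Section Directional.
Context {R : realType} {V : normedModType R}.
Implicit Types (g : V -> R) (x v w : V).

Lemma is_derive_line g x v (s d : R) :
  is_derive s (1:R) (fun s => g (x + s *: v)) d <-> is_derive (x + s *: v) v g d.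
Proof.
suff E : (fun h : R => h^-1 *: (((fun s => g (x + s *: v)) \o shift s) (h *: 1)
            - g (x + s *: v)))
  = (fun h : R => h^-1 *: ((g \o shift (x + s *: v)) (h *: v) - g (x + s *: v))).
  by split=> -[D1 D2]; split; move: D1 D2; rewrite /derivable /derive E.
apply/funext => h /=; rewrite [h *: 1]mulr1 scalerDl.
by rewrite addrCA.
Qed.

Lemma is_derive_line0 g x v (d : R) :
  is_derive (0 : R) (1:R) (fun s => g (x + s *: v)) d <-> is_derive x v g d.
Proof. by rewrite is_derive_line scale0r addr0. Qed.

Lemma is_derive_scale g x v (c d : R) :
  is_derive x v g d -> is_derive x (c *: v) g (c * d).
Proof.
move=> gd; apply/is_derive_line0.
have : is_derive (c * 0 : R) (1:R) (fun s => g (x + s *: v)) d.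
  by rewrite mulr0; apply/is_derive_line0.
move=> /(@is_derive1_comp _ _ (fun s => c * s) 0 d c).
have -> : (fun s => g (x + s *: v)) \o (fun s => c * s) = fun s => g (x + s *: (c *: v)).
  by apply/funext => s /=; rewrite scalerA mulrC.
rewrite mulrC; apply.
rewrite -[X in is_derive _ _ _ X]mulr1.
exact: (@is_deriveZ R R R id c 0 1 1 (is_derive_id _ _)).
Qed.

(** Additivity of the directional derivative without Frechet differentiability:
    the increment along v + w is one along v followed by one along w, and the
    mean value theorem turns the latter into a value of the continuous
    derivative along w near x. *)
Lemma is_derive_add g x v w : derivable g x v -> (forall y, derivable g y w) ->
  {for x, continuous ('D_w g)} -> is_derive x (v + w) g ('D_v g x + 'D_w g x).
Proof.
move=> gv gw cw.
suff : (fun h : R => h^-1 *: ((g \o shift x) (h *: (v + w)) - g x)) @ 0^'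
         --> 'D_v g x + 'D_w g x.
  by move=> h; split; [apply/cvg_ex; eexists; exact: h | exact: cvg_lim h].
have E (h : R) : exists t, (0 <= t <= 1) /\
   g (x + h *: v + h *: w) - g (x + h *: v) =
   h * 'D_w g (x + h *: v + (t * h) *: w).
  have D s : is_derive s (1:R) (fun s => g (x + h *: v + s *: (h *: w)))
       (h * 'D_w g (x + h *: v + s *: (h *: w))).
    by apply/is_derive_line; apply: is_derive_scale; exact/derivableP.
  have [|t] := @MVT_segment R (fun s => g (x + h *: v + s *: (h *: w))) _ 0 1 ler01.
  - by apply: derivable_within_continuous => s _; have [] := D s.
  rewrite in_itv /= subr0 mulr1 scale1r scale0r addr0 => t01 ->; exists t; split => //.
  by rewrite scalerA.
have [th thP] := choice E.
have -> : (fun h : R => h^-1 *: ((g \o shift x) (h *: (v + w)) - g x)) =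
  (fun h : R => h^-1 *: ((g \o shift x) (h *: v) - g x)
     + h^-1 *: (h * 'D_w g (x + h *: v + (th h * h) *: w))).
  apply/funext => h /=; rewrite -(thP h).2 -scalerDr; congr (_ *: _).
  have -> : h *: (v + w) + x = x + h *: v + h *: w.
    by rewrite scalerDr addrC addrA.
  by rewrite [h *: v + x]addrC [RHS]addrC addrA subrK.
apply: cvgD; first exact: gv.
have step : (fun h : R => 'D_w g (x + h *: v + (th h * h) *: w)) @ 0^' --> 'D_w g x.
  have cvx : (fun h : R => x + h *: v + (th h * h) *: w) @ 0^' --> x.
    apply/cvgrPdist_lt => e e0; near=> h.
    rewrite -addrA opprD addNKr normrN.
    have t01 := (thP h).1.
    apply: (@le_lt_trans _ _ (`|h| * (`|v| + `|w|))).
      rewrite (le_trans (ler_normD _ _)) // -scalerA !normrZ mulrDr lerD2l.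
      by rewrite ler_piMl ?mulr_ge0 // ger0_norm; lra.
    apply: (@le_lt_trans _ _ (`|h| * (`|v| + `|w| + 1))).
      by rewrite ler_wpM2l // lerDl.
    rewrite -ltr_pdivlMr; last by rewrite ltr_wpDl // addr_ge0.
    near: h; apply: dnbhs0_lt; rewrite divr_gt0 // ltr_wpDl // addr_ge0 //.
  exact: (cvg_comp _ _ cvx cw).
apply: cvg_trans step; apply: near_eq_cvg; near=> h.
have h0 : h != 0 by near: h; exact: nbhs_dnbhs_neq.
by rewrite /= scalerA mulVf // scale1r.
Unshelve. all: by end_near. Qed.

End Directional.

Section QuadraticWeight.
Context {R : realType}.

Lemma is_derive_quadratic (A B C s : R) :
  is_derive s (1:R) (fun s => A + B * s + C * s ^+ 2) (B + 2 * C * s).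
Proof.
have -> : (fun s : R => A + B * s + C * s ^+ 2) =
    horner (A%:P + B *: 'X + C *: 'X^2).
  by apply/funext => z /=; rewrite !hornerE.
have -> : B + 2 * C * s = ((A%:P + B *: 'X + C *: 'X^2)^`()).[s].
  by rewrite 2!derivD derivC 2!derivZ derivX derivXn !hornerE /=; ring.
exact: is_derive_poly.
Qed.

Lemma is_derive_mul (f g : R -> R) (s df dg : R) :
  is_derive s (1:R) f df -> is_derive s (1:R) g dg ->
  is_derive s (1:R) (fun s => f s * g s) (f s * dg + g s * df).
Proof. by move=> fd gd; exact: is_deriveM. Qed.

(** First and second order conditions for the product of f with the quadratic
    weight A + B s + C s^2 at a local maximum at 0; the restrictions of the
    barrier's paraboloid to lines are such weights. *)
Lemma quadratic_weight_max (f df : R -> R) (A B C c : R) :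
  (forall s, is_derive s (1:R) f (df s)) -> is_derive (0:R) (1:R) df c ->
  (\forall s \near (0:R), (A + B * s + C * s ^+ 2) * f s <= A * f 0) ->
  A * df 0 + B * f 0 = 0 /\ A * c + 2 * B * df 0 + 2 * C * f 0 <= 0.
Proof.
move=> fd dfc mx.
pose w s := (A + B * s + C * s ^+ 2) * f s.
(* B + 2 C s is written with a zero square term: it is again such a weight. *)
pose dw s := (A + B * s + C * s ^+ 2) * df s + f s * (B + 2 * C * s + 0 * s ^+ 2).
have w0 : w 0 = A * f 0 by rewrite /w; ring.
have wd s : is_derive s (1:R) w (dw s).
  rewrite /dw mul0r addr0; apply: is_derive_mul => //; exact: is_derive_quadratic.
have dwd : is_derive (0:R) (1:R) dw (A * c + 2 * B * df 0 + 2 * C * f 0).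
  have -> : A * c + 2 * B * df 0 + 2 * C * f 0 =
    ((A + B * 0 + C * 0 ^+ 2) * c + df 0 * (B + 2 * C * 0)) +
    (f 0 * (2 * C + 2 * 0 * 0) + (B + 2 * C * 0 + 0 * 0 ^+ 2) * df 0) by ring.
  apply: (@is_deriveD _ _ _ (fun s => (A + B * s + C * s ^+ 2) * df s)
            (fun s => f s * (B + 2 * C * s + 0 * s ^+ 2))).
    by apply: is_derive_mul => //; exact: is_derive_quadratic.
  by apply: is_derive_mul => //; exact: is_derive_quadratic.
have wmx : \forall s \near (0:R), w s <= w 0 by rewrite w0.
split.
  by rewrite -[RHS](derive_local_max0 wd wmx) /dw; ring.
apply: (second_derivative_le0 wd dwd).
move: wmx => [r /= r0 H]; exists r => //= s sr.
have := H s sr; have := H (- s); rewrite /= sub0r normrN in sr *.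
rewrite sub0r !normrN => /(_ sr); lra.
Qed.

End QuadraticWeight.

(** * Jets of solutions *)

Section Jets.
Context {R : realType} {n : nat}.
Implicit Types (g : 'rV[R]_n -> R) (p v x : 'rV[R]_n) (H : 'M[R]_n).

(** Second-order data of g at x, tested on the restrictions of g to lines
    through x.  Only the quadratic form of H is constrained. *)
Definition second_jet g x p H : Prop := forall v, exists df : R -> R,
  [/\ forall s, is_derive s (1:R) (fun s => g (x + s *: v)) (df s),
      df 0 = dot p v & is_derive (0:R) (1:R) df (qform H v)].

Lemma derive_rowE g x v :
  (forall w, (forall y, derivable g y w) /\ continuous ('D_w g)) ->
  'D_v g x = \sum_i v 0 i * pderiv i g x.
Proof.
move=> C1.
suff : is_derive x (\sum_i v 0 i *: delta_mx 0 i) g (\sum_i v 0 i * pderiv i g x).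
  by rewrite -row_sum_delta => -[].
apply: (big_ind2 (fun w d => is_derive x w g d)).
- rewrite -(scale0r 0) -[X in is_derive _ _ _ X](mul0r ('D_0 g x)).
  by apply: is_derive_scale; apply/derivableP; apply: (C1 _).1.
- move=> w1 d1 w2 d2 [_ <-] [_ <-].
  apply: is_derive_add; [exact: (C1 _).1 | exact: (C1 _).1 | exact: (C1 _).2].
- by move=> i _; apply: is_derive_scale; apply/derivableP; apply: (C1 _).1.
Qed.

Lemma C2_second_jet g x : Ck_on 2 setT g ->
  second_jet g x (\row_i pderiv i g x) (\matrix_(i, j) pderiv i (pderiv j g) x).
Proof.
move=> [_ C]; have C1 w : (forall y, derivable g y w) /\ continuous ('D_w g).
  by have [D1 [D2 _]] := C w; split => y; [exact: D1 | exact: D2].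
have C2 w z : (forall y, derivable ('D_w g) y z) /\ continuous ('D_z ('D_w g)).
  have [_ [_ /(_ z)[D1 [D2 _]]]] := C w.
  by split => y; [exact: D1 | exact: D2].
move=> v; exists (fun s => 'D_v g (x + s *: v)); split.
- by move=> s; apply/is_derive_line; apply/derivableP; exact: (C1 _).1.
- rewrite scale0r addr0 derive_rowE // dotC.
  by apply: eq_bigr => i _; rewrite mxE.
- apply: (proj2 (@is_derive_line0 _ _ ('D_v g) x v _)).
  have -> : qform (\matrix_(i, j) pderiv i (pderiv j g) x) v
      = 'D_v ('D_v g) x; last by apply/derivableP; exact: (C2 _ _).1.
  rewrite derive_rowE //; apply: eq_bigr => i _.
  have -> : 'D_v g = \sum_j v 0 j *: pderiv j g.
    apply/funext => y; rewrite derive_rowE // fct_sumE.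
    by apply: eq_bigr.
  rewrite [pderiv i (\sum_j _)]/pderiv derive_sum; last first.
    by move=> j; apply: derivableZ; exact: (C2 _ _).1.
  rewrite mulr_sumr; apply: eq_bigr => j _; rewrite deriveZ /=; last exact: (C2 _ _).1.
  by rewrite mxE [_ *: _]/(_ * _) mulrA.
Qed.

Lemma continuous_section (t : R) : continuous (fun x : 'rV[R]_n => (x, t)).
Proof.
move=> x; apply: (@cvg_pair _ _ _ (nbhs x) (nbhs x) (nbhs t)).
  exact: cvg_id.
exact: cvg_cst.
Qed.

(** A spatial derivative of the slice is the derivative of f in the direction
    (v, 0), with literally the same difference quotients. *)
Lemma Ck_on_slice (T t : R) k (f : 'rV[R]_n * R -> R) : 0 < t < T ->
  Ck_on k ([set p | 0 < p.2 < T] : set ('rV[R]_n * R)%type) f ->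
  Ck_on k setT (fun x => f (x, t)).
Proof.
move=> tT; elim: k f => [|k IH] f [cf df].
  split => // x _.
  apply: (@continuous_comp _ _ _ (fun x : 'rV[R]_n => (x, t)) f); last exact: cf.
  exact: continuous_section.
split.
  move=> x _.
  apply: (@continuous_comp _ _ _ (fun x : 'rV[R]_n => (x, t)) f); last exact: cf.
  exact: continuous_section.
move=> v; have [Df Cf] := df (v, 0).
have E x : (fun h : R => h^-1 *: (((fun x => f (x, t)) \o shift x) (h *: v) - f (x, t)))
   = (fun h : R => h^-1 *: ((f \o shift (x, t)) (h *: (v, 0)) - f (x, t))).
  apply/funext => h /=; congr (_ *: (f _ - _)).
  by rewrite [RHS]/GRing.add /= /add_pair /= [h *: (0:R)]mulr0 add0r.
split => [x _|].
  by move: (Df (x, t) tT); rewrite /derivable E.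
have -> : 'D_v (fun x => f (x, t)) = (fun x => 'D_(v, 0) f (x, t)).
  by apply/funext => x; rewrite /derive E.
exact: (IH ('D_(v, 0) f) Cf).
Qed.

Lemma mcf_solution_jet (T t : R) (u : 'rV[R]_n -> R -> R) x :
  smooth_graphical_mcf T u -> 0 < t < T ->
  exists p H, second_jet (u ^~ t) x p H /\
              is_derive t (1:R) (u x) (mcf_trace p H).
Proof.
move=> [su ue] tT.
exists (\row_i pderiv i (u ^~ t) x), (\matrix_(i, j) pderiv i (pderiv j (u ^~ t)) x).
split.
  exact/C2_second_jet/(Ck_on_slice tT (su 2%N)).
suff -> : mcf_trace (\row_i pderiv i (u ^~ t) x)
    (\matrix_(i, j) pderiv i (pderiv j (u ^~ t)) x) = 'D_1 (u x) t.
  apply/derivableP; have [_ /(_ (0, 1))[D _]] := su 1%N.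
  move: (D (x, t) tT); rewrite /derivable.
  have -> // : (fun h : R => h^-1 *: (((fun p : 'rV[R]_n * R => u p.1 p.2) \o
        shift (x, t)) (h *: (0, 1)) - u x t))
     = (fun h : R => h^-1 *: ((u x \o shift t) (h *: (1:R)) - u x t)).
  apply/funext => h /=; congr (_ *: (u _ _ - _)).
  by rewrite scaler0 add0r.
rewrite -derive1E ue //; apply: eq_bigr => i _; apply: eq_bigr => j _.
rewrite !mxE /sqr_norm_grad /dot.
by congr ((_ - _ / (1 + _)) * _); apply: eq_bigr => k _; rewrite !mxE.
Qed.

Lemma mcf_solution_continuous (T t : R) (u : 'rV[R]_n -> R -> R) x :
  smooth_graphical_mcf T u -> 0 < t < T ->
  {for (x, t), continuous (fun p : 'rV[R]_n * R => u p.1 p.2)}.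
Proof. by move=> [su _] tT; have [c _] := su 0%N; exact: c. Qed.

End Jets.

(** * First touching times, initial data and convexity *)

Section SpaceTime.
Context {R : realType} {n : nat}.
Implicit Types (x y : 'rV[R]_n) (t s T r c : R).

Lemma compact_norm_ball r : compact [set x : 'rV[R]_n | `|x| <= r].
Proof.
apply: bounded_closed_compact.
  exists r; split; first exact: num_real.
  by move=> M rM x /= xr; rewrite (le_trans xr) // ltW.
apply: (@closed_comp _ _ (fun x : 'rV[R]_n => `|x|) [set z | z <= r]).
  by move=> x _; exact: norm_continuous.
exact: closed_le.
Qed.

Lemma continuous_superlevel_closed (K : set ('rV[R]_n * R)) (f : 'rV[R]_n * R -> R) c :
  closed K -> (forall p, K p -> {for p, continuous f}) ->
  closed [set p | K p /\ c <= f p].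
Proof.
move=> cK cf p clp.
have Kp : K p.
  by apply: cK => B /clp [q [[Kq _] Bq]]; exists q.
split=> //; rewrite leNgt; apply/negP => fp.
have /clp [q [[_ cq] /= qc]] : nbhs p [set q | f q < c].
  exact: (cf p Kp _ (open_nbhs_nbhs (conj (@open_lt _ c) fp))).
by rewrite ltNge cq in qc.
Qed.

(** Superlevel sets of f bounded in space and away from t = 0 are compact up to
    any given time, so the level c is reached at a first time t.  Before t one
    has f < c, and continuity in time extends f <= c to the whole slice at time
    t; the touching point is therefore a spatial maximum. *)
Lemma first_touching_time (f : 'rV[R]_n * R -> R) T r t0 c :
  (forall x t, 0 < t < T -> {for (x, t), continuous f}) -> 0 < t0 ->
  (forall x t, 0 < t < T -> c <= f (x, t) -> `|x| <= r /\ t0 <= t) ->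
  forall x1 t1, 0 < t1 < T -> c <= f (x1, t1) ->
  exists x t, [/\ 0 < t < T, f (x, t) = c, forall y, f (y, t) <= c
                & forall s, 0 < s < t -> f (x, s) <= c].
Proof.
move=> cf t00 bd x1 t1 t1T f1.
pose K : set ('rV[R]_n * R) := [set x : 'rV[R]_n | `|x| <= r] `*` `[t0, t1].
have cK : compact K.
  by apply: compact_setX; [exact: compact_norm_ball | exact: segment_compact].
pose B := [set p | K p /\ c <= f p].
have cB : compact B.
  apply: (subclosed_compact _ cK); last by move=> p [].
  apply: continuous_superlevel_closed.
    by apply: compact_closed => //; exact: norm_hausdorff.
  move=> [x t] [/= _]; rewrite in_itv /= => tt; apply: cf; lra.
have [xr1 tr1] := bd _ _ t1T f1.
have B1 : B (x1, t1) by split => //; split => //=; rewrite in_itv /= lexx andbT.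
have csnd : continuous (snd : 'rV[R]_n * R -> R) by move=> p; exact: cvg_snd.
have [[x t]] := compact_EVT_min (ex_intro _ _ B1) cB (continuous_subspaceT csnd).
rewrite inE => -[[/= xr]]; rewrite in_itv /= => tt fxt mn.
have tT : 0 < t < T by lra.
have before y s : 0 < s < t -> f (y, s) < c.
  move=> st; rewrite ltNge; apply/negP => fys.
  have sT : 0 < s < T by lra.
  have [yr sr] := bd _ _ sT fys.
  have : t <= s.
    apply: (mn (y, s)); rewrite inE; split => //; split => //=.
    by rewrite in_itv /=; lra.
  lra.
(* A value above c at time t would persist slightly before t. *)
have now y : f (y, t) <= c.
  rewrite leNgt; apply/negP => fy.
  have : nbhs t [set s | c < f (y, s)].
    have cyt : {for t, continuous (fun s => f (y, s))}.
      apply: (@continuous_comp _ _ _ (fun s : R => (y, s)) f); last exact: cf.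
      apply: (@cvg_pair _ _ _ (nbhs t) (nbhs y) (nbhs t)); first exact: cvg_cst.
      exact: cvg_id.
    exact: (cyt _ (open_nbhs_nbhs (conj (@open_gt _ c) fy))).
  move=> [e /= e0 H].
  pose h := Num.min (e / 2) (t / 2).
  have h0 : 0 < h by rewrite lt_min; apply/andP; split; lra.
  have he : h < e by rewrite gt_min; apply/orP; left; lra.
  have ht : h < t by rewrite gt_min; apply/orP; right; lra.
  have := H (t - h); rewrite /= opprB addrC subrK gtr0_norm // => /(_ he).
  have := before y (t - h); have : 0 < t - h < t by lra.
  by move=> -> /(_ isT); lra.
exists x, t; split => //.
- by apply/eqP; rewrite eq_le now fxt.
- by move=> s st; rewrite ltW // before.
Qed.

Lemma initial_data_uniform (u : 'rV[R]_n -> R -> R) u0 r e :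
  has_initial_data u u0 -> 0 < e ->
  exists2 t0, 0 < t0 & forall t x, 0 < t < t0 -> `|x| <= r ->
    `|u x t - u0 x| < e.
Proof.
move=> /fam_cvgP /(_ _ (@compact_norm_ball r)) ui e0.
have : nbhs (u0 : {uniform` [set x : 'rV[R]_n | `|x| <= r] -> R})
   [set h | forall y, `|y| <= r -> `|h y - u0 y| < e].
  apply/uniform_nbhs; exists [set xy | ball xy.1 e xy.2]; split.
    by rewrite -entourage_ballE; exists e.
  by move=> h H y yr; rewrite distrC; exact: H.
move=> /ui /=; rewrite near_simpl near_withinE => -[d /= d0 H].
exists d => // t x /andP[t0 td] xr; apply: (H t) => //=.
by rewrite sub0r normrN gtr0_norm.
Qed.

Lemma convex_entire_graphP (g : 'rV[R]_n -> R) a x y : convex_entire_graph g ->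
  0 <= a <= 1 -> g (a *: x + (1 - a) *: y) <= a * g x + (1 - a) * g y.
Proof.
move=> cg /andP[a0 a1].
by have := cg (Itv01 a0 a1) x y (in_setT _) (in_setT _).
Qed.

End SpaceTime.

(** * Consequences of convexity and of the initial condition *)

Section Solutions.
Context {R : realType} {n : nat} (T : R).
Implicit Types (x v p : 'rV[R]_n) (H : 'M[R]_n) (t : R).

Lemma convex_jet_ge0 (g : 'rV[R]_n -> R) x p H v :
  convex_entire_graph g -> second_jet g x p H -> 0 <= qform H v.
Proof.
move=> cg /(_ v)[df [gd _ dfd]]; rewrite -oppr_le0.
have gNd s : is_derive s (1:R) (fun s => - g (x + s *: v)) (- df s).
  exact: is_deriveN.
have dfNd : is_derive (0:R) (1:R) (fun s => - df s) (- qform H v).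
  exact: is_deriveN.
apply: (second_derivative_le0 gNd dfNd).
exists 1 => //= s _; rewrite scale0r addr0.
have half : 0 <= (2^-1 : R) <= 1 by lra.
have := convex_entire_graphP (x + s *: v) (x + (- s) *: v) cg half.
have -> : 2^-1 *: (x + s *: v) + (1 - 2^-1) *: (x + (- s) *: v) = x.
  apply/rowP => i; rewrite !mxE; field; lra.
lra.
Qed.

Context (u : 'rV[R]_n -> R -> R) (u0 : 'rV[R]_n -> R).
Context (u_mcf : smooth_graphical_mcf T u) (u_init : has_initial_data u u0).

(** A convex solution is nondecreasing in time because a(Du) : D^2 u >= 0. *)
Lemma convex_mcf_ge_initial x t :
  (forall t, 0 < t < T -> convex_entire_graph (u ^~ t)) ->
  0 < t < T -> u0 x <= u x t.
Proof.
move=> u_convex tT; rewrite leNgt; apply/negP => ut.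
have [|t0 t00 H] := initial_data_uniform `|x| u_init (e := u0 x - u x t).
  lra.
pose s := Num.min (t0 / 2) (t / 2).
have s0 : 0 < s by rewrite lt_min; apply/andP; split; lra.
have st0 : s < t0 by rewrite gt_min; apply/orP; left; lra.
have st : s < t by rewrite gt_min; apply/orP; right; lra.
have : `|u x s - u0 x| < u0 x - u x t by apply: H => //; rewrite s0.
rewrite ltr_norml => /andP[+ _].
have /choice [du duP] : forall z, exists d : R, 0 < z < T ->
    is_derive z (1:R) (u x) d /\ 0 <= d.
  move=> z; have [zT|] := boolP (0 < z < T); last by exists 0.
  have [p [H' [J D]]] := mcf_solution_jet x u_mcf zT.
  exists (mcf_trace p H') => _; split => //; apply: mcf_trace_ge0 => v.
  exact: convex_jet_ge0 (u_convex _ zT) J.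
have : u x s <= u x t.
  apply: (@derive_ge0_le _ (u x) du s t); last exact: ltW.
    by move=> z zz; apply: (duP z _).1; lra.
  by move=> z zz; apply: (duP z _).2; lra.
lra.
Qed.

(** The initial datum is within 1, on a ball, of a continuous time slice. *)
Lemma initial_data_bounded r : 0 < T ->
  exists M, forall x, `|x| <= r -> `|u0 x| <= M.
Proof.
move=> T0; have [t0 t00 H] := initial_data_uniform r u_init ltr01.
pose t := Num.min (t0 / 2) (T / 2).
have s0 : 0 < t by rewrite lt_min; apply/andP; split; lra.
have st0 : t < t0 by rewrite gt_min; apply/orP; left; lra.
have st : t < T by rewrite gt_min; apply/orP; right; lra.
have tT : 0 < t < T by rewrite s0.
have cut : continuous (fun x => u x t).
  move=> x.
  apply: (@continuous_comp _ _ _ (fun x : 'rV[R]_n => (x, t))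
    (fun p : 'rV[R]_n * R => u p.1 p.2)); first exact: continuous_section.
  exact: mcf_solution_continuous u_mcf tT.
have cu : continuous (fun x => `|u x t|).
  move=> x; apply: (@continuous_comp _ _ _ (fun x => u x t) Num.norm).
    exact: cut.
  exact: norm_continuous.
have B0 : [set x : 'rV[R]_n | `|x| <= `|r|] 0 by rewrite /= normr0.
have [c _ cM] := compact_EVT_max (ex_intro _ _ B0) (@compact_norm_ball _ _ `|r|)
  (continuous_subspaceT cu).
exists (`|u c t| + 1) => x xr.
have := cM x; rewrite inE /= (le_trans xr (ler_norm _)) => /(_ isT).
have h1 : `|u x t - u0 x| < 1 by apply: H => //; rewrite s0.
move=> h2; rewrite -[u0 x](subKr (u x t)) (le_trans (ler_normB _ _)) //.
by rewrite lerD // ltW.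
Qed.

End Solutions.

(** * The shrinking barrier *)

Section Barrier.
Context {R : realType} {n : nat} (T : R).
Implicit Types (x v p : 'rV[R]_n) (H : 'M[R]_n) (t : R).

Let le_of_eq (a b : R) : a = b -> a <= b.
Proof. by move=> ->. Qed.

(** The library norm is the sup norm, the dot product is Euclidean. *)
Lemma norm_le_dot x r : 0 <= r -> dot x x <= r ^+ 2 -> `|x| <= r.
Proof.
move=> r0 xr; rewrite /Num.norm /= mx_normrE; apply: bigmax_le => // -[i j] _ /=.
rewrite ord1 -ler_sqr ?nnegrE // real_normK ?num_real //.
apply: le_trans xr; rewrite /dot (bigD1 j) //= expr2 lerDl.
by apply: sumr_ge0 => k _; rewrite -expr2 sqr_ge0.
Qed.

(** The space-time region where this function is positive lies over the Euclidean
    ball of radius rho and shrinks with speed 2 n + 3 in the squared radius.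
    Spheres evolving by mean curvature shrink with speed 2 n; the excess pays
    for the barrier blowing up on the boundary of the region. *)
Definition paraboloid (rho : R) (x0 : 'rV[R]_n) (p : 'rV[R]_n * R) : R :=
  rho ^+ 2 - dot (p.1 - x0) (p.1 - x0) - (n%:R * 2 + 3) * p.2.

Lemma paraboloid_continuous rho x0 : continuous (paraboloid rho x0).
Proof.
move=> p; apply: cvgB; last first.
  by apply: cvgM; [exact: cvg_cst | exact: cvg_snd].
apply: cvgB; first exact: cvg_cst.
rewrite /dot; apply: cvg_big => [|i _]; first exact: add_continuous.
have c : ((q.1 - x0) 0 i) @[q --> p] --> (p.1 - x0) 0 i.
  have cc : continuous (fun q : 'rV[R]_n * R => q.1 - x0).
    by move=> q; apply: cvgB; [exact: cvg_fst | exact: cvg_cst].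
  apply: (@continuous_comp _ _ _ (fun q : 'rV[R]_n * R => q.1 - x0)
    (fun x : 'rV[R]_n => x 0 i)); first exact: cc.
  exact: coord_continuous.
exact: cvgM.
Qed.

Lemma paraboloid_line rho x0 x v s t :
  paraboloid rho x0 (x + s *: v, t) =
  paraboloid rho x0 (x, t) + (- 2 * dot (x - x0) v) * s + (- dot v v) * s ^+ 2.
Proof.
rewrite /paraboloid /= (addrAC x); move: (x - x0) => y.
by rewrite dotDl !dotDr !dotZl !dotZr (dotC v y); ring.
Qed.

Context (u : 'rV[R]_n -> R -> R) (u0 : 'rV[R]_n -> R).
Context (u_mcf : smooth_graphical_mcf T u) (u_init : has_initial_data u u0).

(** The barrier is S + rho^3 / psi, with psi the paraboloid function: it blows up
    on the boundary of the region where psi > 0, hence u could only touch it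
    inside.  The contact condition is written (u - S) psi = rho^3, and psi is
    replaced by its positive part so that the product exceeds no positive level
    outside the region.  With U = u - S, P = psi and y = x - x0 at a contact point, the
    spatial conditions give Du = (2 U / P) y and
    P D^2 u <= (8 U / P) y y^T + 2 U I, so that
    P a(Du) : D^2 u <= 2 P / U + 2 n U, while the time condition gives
    (2 n + 3) U <= P u_t.  Since P <= rho^2 and P U = rho^3 imply P <= U^2, the
    right-hand side 2 P / U is at most 2 U, which is a contradiction. *)
Lemma mcf_barrier rho S x0 t : 0 < rho ->
  (forall z, `|z - x0| <= rho -> u0 z <= S) ->
  0 < t < T -> 1 <= rho ^+ 2 - (n%:R * 2 + 3) * t -> u x0 t <= S + rho ^+ 3.
Proof.
move=> rho0 uS tT1 big; rewrite leNgt; apply/negP => ut.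
pose psi := paraboloid rho x0.
pose f (p : 'rV[R]_n * R) := Num.max 0 (psi p) * (u p.1 p.2 - S).
have r3 : 0 < rho ^+ 3 by rewrite exprn_gt0.
have n0 : 0 <= n%:R :> R by [].
have cf x t' : 0 < t' < T -> {for (x, t'), continuous f}.
  move=> t'T; apply: cvgM.
    by apply: continuous_max; [exact: cvg_cst | exact: paraboloid_continuous].
  apply: cvgB; last exact: cvg_cst.
  exact: mcf_solution_continuous u_mcf t'T.
have fpos x t' : 0 < f (x, t') ->
    0 < psi (x, t') /\ f (x, t') = psi (x, t') * (u x t' - S).
  rewrite /f /=; case: (ltP 0 (psi (x, t'))) => // _; by rewrite mul0r ltxx.
have near_x0 x t' : 0 < t' -> 0 < psi (x, t') ->
    `|x - x0| <= rho /\ psi (x, t') <= rho ^+ 2.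
  move=> t'0; rewrite /psi /paraboloid /= => ps.
  have d0 : 0 <= (n%:R * 2 + 3) * t' by rewrite mulr_ge0 ?ltW //; lra.
  have d1 := dot_ge0 (x - x0).
  split; last by lra.
  apply: norm_le_dot; [exact: ltW | lra].
(* Initially U < rho / 2 and psi <= rho^2, so the product is below rho^3 / 2. *)
have [|t0 t00 H0] := initial_data_uniform (`|x0| + rho) u_init (e := rho / 2).
  lra.
have [||x [t' [t'T fx mx mt]]] := @first_touching_time R n f T
   (`|x0| + rho) t0 (rho ^+ 3) cf t00 _ x0 t tT1.
- move=> x s sT fx; have [ps fE] := fpos x s (lt_le_trans r3 fx).
  have [xr psr] : `|x - x0| <= rho /\ psi (x, s) <= rho ^+ 2 by apply: near_x0 => //; lra.
  have xR : `|x| <= `|x0| + rho.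
    by rewrite -[x](subrK x0) addrC (le_trans (ler_normD _ _)) // lerD2l.
  split => //; rewrite leNgt; apply/negP => st0.
  have : `|u x s - u0 x| < rho / 2 by apply: H0 => //; lra.
  rewrite ltr_norml => /andP[_ us]; have := uS x xr => u0S.
  rewrite fE in fx.
  have U0 : 0 < u x s - S by rewrite -(pmulr_rgt0 _ ps); lra.
  have : psi (x, s) * (u x s - S) <= rho ^+ 2 * (rho / 2).
    by apply: ler_pM => //; [exact: ltW | exact: ltW | lra].
  have -> : rho ^+ 2 * (rho / 2) = rho ^+ 3 / 2 by field.
  lra.
- rewrite /f /= /psi /paraboloid /= subrr /dot big1 ?subr0; last first.
    by move=> i _; rewrite mxE mul0r.
  rewrite max_r; last by lra.
  by rewrite -[leLHS]mul1r ler_pM //; lra.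
have [P0 fE] := fpos x t' (ltac:(by rewrite fx)).
have [xr Pr] : `|x - x0| <= rho /\ psi (x, t') <= rho ^+ 2 by apply: near_x0 => //; lra.
have [p [H [J D]]] := mcf_solution_jet x u_mcf t'T.
set P := psi (x, t') in P0 fE Pr *.
set U := u x t' - S in fE *.
rewrite fx in fE.
have U0 : 0 < U by rewrite -(pmulr_rgt0 _ P0) -fE.
set y := x - x0.
(* The weight psi restricted to a line through x is quadratic. *)
have max_line v : dot p v = (2 * U / P) * dot y v /\
    P * qform H v <= 2 * U * dot v v + 4 * dot y v * dot p v.
  have [df [fd df0 dfd]] := J v.
  have fdS s : is_derive s (1:R) (fun s => u (x + s *: v) t' - S) (df s).
    rewrite -[X in is_derive _ _ _ X]subr0.
    by apply: is_deriveB; exact: is_derive_cst.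
  have [|E1 E2] := @quadratic_weight_max R (fun s => u (x + s *: v) t' - S) df P
     (- 2 * dot y v) (- dot v v) _ fdS dfd.
    have cl : {for (0:R), continuous (fun s : R => psi (x + s *: v, t'))}.
      have -> : (fun s : R => psi (x + s *: v, t')) =
         (fun s => P + (- 2 * dot y v) * s + (- dot v v) * s ^+ 2).
        by apply/funext => s; rewrite /psi paraboloid_line.
      have [dq _] := is_derive_quadratic P (- 2 * dot y v) (- dot v v) 0.
      exact/differentiable_continuous/derivable1_diffP.
    have : \forall s \near (0:R), 0 < psi (x + s *: v, t').
      apply: (cl _ (open_nbhs_nbhs (conj (@open_gt _ 0) _))).
      by rewrite /= scale0r addr0.
    apply: filterS => s ps; rewrite -paraboloid_line scale0r addr0 -fE.
    by have := mx (x + s *: v); rewrite /f /= max_r // ltW.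
  rewrite df0 /= scale0r addr0 -/U in E1 E2; split; last by lra.
  have Pn : P != 0 by rewrite gt_eqF.
  apply: (mulfI Pn); 
  have -> : P * (2 * U / P * dot y v) = 2 * U * dot y v by field.
  lra.
have k0 : 0 < 2 * U / P by rewrite divr_gt0 // mulr_gt0.
have pE : p = (2 * U / P) *: y.
  by apply: dot_inj => v; rewrite dotZl (max_line v).1.
have space : P * mcf_trace p H <= 2 * P / U + 2 * U * n%:R.
  rewrite -mcf_traceZ.
  apply: (@le_trans _ _ (mcf_trace p (rank1_plus_scalar (8 * U / P) (2 * U) y))).
    apply: mcf_trace_mono => v; rewrite qformZ qform_rank1_plus_scalar.
    have [-> h] := max_line v; apply: (le_trans (max_line v).2).
    rewrite (max_line v).1 addrC lerD2r; apply: le_of_eq; ring.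
  rewrite pE; apply: le_trans (mcf_trace_rank1_plus_scalar _ _ _ k0) _.
  - by rewrite divr_ge0 ?mulr_ge0 // ltW.
  - by rewrite mulr_ge0 // ltW.
  - rewrite lerD2r; apply: le_of_eq; field.
    by rewrite !gt_eqF.
have time : (n%:R * 2 + 3) * U <= P * mcf_trace p H.
  have t'0 : 0 < t' by lra.
  have Dw : is_derive t' (1:R) (fun s =>
         ((P + (n%:R * 2 + 3) * t') + - (n%:R * 2 + 3) * s + 0 * s ^+ 2)
         * (u x s - S)) (P * mcf_trace p H - (n%:R * 2 + 3) * U).
    have -> : P * mcf_trace p H - (n%:R * 2 + 3) * U =
       ((P + (n%:R * 2 + 3) * t') + - (n%:R * 2 + 3) * t' + 0 * t' ^+ 2)
       * (mcf_trace p H - 0)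
       + (u x t' - S) * (- (n%:R * 2 + 3) + 2 * 0 * t') by rewrite -/U; ring.
    apply: is_derive_mul; first exact: is_derive_quadratic.
  rewrite -subr_ge0; apply: (derive_past_max_ge0 t'0 Dw) => s st.
  have E : (P + (n%:R * 2 + 3) * t') + - (n%:R * 2 + 3) * s + 0 * s ^+ 2 = psi (x, s).
    by rewrite /P /psi /paraboloid /=; ring.
  have ps : 0 < psi (x, s).
    rewrite -E; have : 0 <= (n%:R * 2 + 3) * (t' - s) by rewrite mulr_ge0 //; lra.
    lra.
  have fs : psi (x, s) * (u x s - S) <= rho ^+ 3.
    have := mt s st; rewrite /f /= max_r //; exact: ltW.
  rewrite E; apply: (le_trans fs); rewrite fE -/U.
  by apply: le_of_eq; ring.
have PU : P <= U ^+ 2.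
  have : P ^+ 2 * P <= P ^+ 2 * U ^+ 2.
    have -> : P ^+ 2 * U ^+ 2 = (rho ^+ 2) ^+ 3 by rewrite -exprMn -fE -!exprM.
    by rewrite -exprSr lerXn2r // nnegrE ltW // exprn_gt0.
  by rewrite ler_pM2l // exprn_gt0.
have : 2 * P / U <= 2 * U.
  by rewrite ler_pdivrMr // -mulrA ler_pM2l // -expr2.
lra.
Qed.

End Barrier.

(** * Comparison with contracted solutions *)

Section Comparison.
Context {R : realType} {n : nat} (T : R).
Implicit Types (x v p : 'rV[R]_n) (H : 'M[R]_n) (t : R).

Lemma proper_bounded_below (u0 : 'rV[R]_n -> R) :
  proper_entire_graph u0 -> (forall r, exists M, forall x, `|x| <= r -> `|u0 x| <= M) ->
  exists m, forall x, m <= u0 x.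
Proof.
move=> pu bu; have [r rP] := pu 0; have [M MP] := bu r.
exists (Num.min 0 (- M)) => x; have [xr|rx] := leP `|x| r.
  by rewrite ge_min; apply/orP; right; have := MP x xr; rewrite ler_norml => /andP[].
by rewrite ge_min rP // ltW.
Qed.

Context (u0 : 'rV[R]_n -> R) (u1 u2 : 'rV[R]_n -> R -> R).
Context (T0 : 0 < T) (u0_convex : convex_entire_graph u0)
  (u0_proper : proper_entire_graph u0)
  (u1_mcf : smooth_graphical_mcf T u1) (u2_mcf : smooth_graphical_mcf T u2)
  (u1_convex : forall t : R, 0 < t < T -> convex_entire_graph (u1 ^~ t))
  (u2_convex : forall t : R, 0 < t < T -> convex_entire_graph (u2 ^~ t))
  (u1_init : has_initial_data u1 u0) (u2_init : has_initial_data u2 u0).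

(** A point z of the ball of radius rho about mu x is mu x + (1 - mu) y with
    |y| <= rho / (1 - mu), which bounds u0 z by mu u0 x plus a constant; rho is
    chosen so large that the barrier over this ball lasts up to time T. *)
Lemma contracted_upper_bound mu : 0 < mu < 1 ->
  exists C, forall x t, 0 < t < T -> u1 (mu *: x) t <= mu * u0 x + C.
Proof.
move=> mu01.
pose rho : R := (n%:R * 2 + 3) * T + 1.
have n0 : 0 <= n%:R :> R by [].
have nT : 0 <= (n%:R * 2 + 3) * T by rewrite mulr_ge0 ?ltW //; lra.
have [M MP] := initial_data_bounded u1_mcf u1_init (rho / (1 - mu)) T0.
exists ((1 - mu) * M + rho ^+ 3) => x t tT; rewrite addrA.
have rho1 : 1 <= rho by rewrite /rho; lra.
apply: (mcf_barrier u1_mcf u1_init) => //.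
- lra.
- move=> z zx; pose y := (1 - mu)^-1 *: (z - mu *: x).
  have m1 : 1 - mu != 0 by rewrite gt_eqF //; lra.
  have -> : z = mu *: x + (1 - mu) *: y.
    by rewrite /y scalerA mulfV // scale1r addrC subrK.
  have yr : `|y| <= rho / (1 - mu).
    by rewrite /y normrZ gtr0_norm ?invr_gt0 ?subr_gt0 1?mulrC ?ler_pM2r
       ?invr_gt0 ?subr_gt0; lra.
  apply: (le_trans (convex_entire_graphP x y u0_convex (a := mu) _)); first by lra.
  rewrite lerD2l ler_pM2l; last by lra.
  by rewrite (le_trans (ler_norm _)) // MP.
- have h1 : (n%:R * 2 + 3) * t <= rho - 1.
    rewrite /rho addrK ler_pM2l; [exact: ltW (andP tT).2 | lra].
  have h2 : rho <= rho ^+ 2 by rewrite expr2 ler_peMl //; lra.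
  lra.
Qed.

(** Maximum principle for u1(mu x, mu^2 t) - u2(x, t) - d t.  The slope d makes
    the time condition at the contact point strict; it is eliminated by letting
    d -> 0. *)
Lemma contracted_comparison mu x t m : 0 < mu < 1 -> (forall x, m <= u0 x) ->
  0 < t < T -> u1 (mu *: x) (mu ^+ 2 * t) <= u2 x t + (1 - mu) * (u0 0 - m).
Proof.
move=> mu01 m_le tT.
apply/ler_addgt0Pr => e e0.
pose d := e / (1 + t).
have d0 : 0 < d by rewrite divr_gt0 //; lra.
suff : u1 (mu *: x) (mu ^+ 2 * t) - u2 x t - d * t < (1 - mu) * (u0 0 - m) + d.
  have -> : e = d + d * t by rewrite /d; field; lra.
  lra.
rewrite ltNge; apply/negP => bad.
pose c := (1 - mu) * (u0 0 - m) + d.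
pose f (p : 'rV[R]_n * R) := u1 (mu *: p.1) (mu ^+ 2 * p.2) - u2 p.1 p.2 - d * p.2.
have mu2 : 0 < mu ^+ 2 < 1 by rewrite exprn_gt0 ?expr_lt1 //; lra.
have mT s : 0 < s < T -> 0 < mu ^+ 2 * s < T.
  move=> sT; apply/andP; split; first by rewrite mulr_gt0 //; lra.
  apply: (@lt_trans _ _ s); last by lra.
  by rewrite gtr_pMl; lra.
have c00 : 0 <= (1 - mu) * (u0 0 - m) by rewrite mulr_ge0 ?subr_ge0 //; lra.
have cf y s : 0 < s < T -> {for (y, s), continuous f}.
  move=> sT; apply: cvgB; last by apply: cvgM; [exact: cvg_cst | exact: cvg_snd].
  apply: cvgB; last exact: mcf_solution_continuous u2_mcf sT.
  apply: (@continuous_comp _ _ _ (fun p : 'rV[R]_n * R => (mu *: p.1, mu ^+ 2 * p.2))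
     (fun p : 'rV[R]_n * R => u1 p.1 p.2)).
    apply: (@cvg_pair _ _ _ (nbhs (y, s)) (nbhs (mu *: y)) (nbhs (mu ^+ 2 * s))).
      by apply: cvgZr; exact: cvg_fst.
    by apply: cvgM; [exact: cvg_cst | exact: cvg_snd].
  exact: mcf_solution_continuous u1_mcf (mT _ sT).
have [C CP] := contracted_upper_bound mu01.
(* Where f > 0 one has u0 <= u2 < mu u0 + C, that is u0 < C / (1 - mu). *)
have [r rP] := u0_proper (C / (1 - mu)).
have [t0 t00 H0] := initial_data_uniform r u1_init d0.
have [||y [s [sT fy my ms]]] := @first_touching_time R n f T r t0 c cf t00 _ x t tT.
- move=> y s sT; rewrite /f /= /c => fy.
  have u2y := convex_mcf_ge_initial u2_mcf u2_init y u2_convex sT.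
  have ds : 0 < d * s by rewrite mulr_gt0 //; lra.
  have yr : `|y| <= r.
    rewrite leNgt; apply/negP => /ltW/rP.
    rewrite ler_pdivrMr; last by lra.
    have := CP y _ (mT _ sT); lra.
  split => //; rewrite leNgt; apply/negP => st0.
  have : `|u1 (mu *: y) (mu ^+ 2 * s) - u0 (mu *: y)| < d.
    apply: H0.
      rewrite mulr_gt0 /=; [|lra..].
      by apply: lt_trans st0; rewrite gtr_pMl; lra.
    rewrite normrZ gtr0_norm; last by lra.
    by apply: le_trans yr; rewrite ler_piMl //; lra.
  rewrite ltr_norml => /andP[_ h1].
  have := convex_entire_graphP y 0 u0_convex (a := mu).
  rewrite scaler0 addr0 => /(_ ltac:(lra)) h2.
  have h3 : (1 - mu) * m <= (1 - mu) * u0 y by rewrite ler_pM2l //; lra.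
  lra.
- by [].
have [p1 [H1 [J1 D1]]] := mcf_solution_jet (mu *: y) u1_mcf (mT _ sT).
have [p2 [H2 [J2 D2]]] := mcf_solution_jet y u2_mcf sT.
(* Both solutions restricted to the line through y in the direction v. *)
have max_line v : dot p2 v = dot (mu *: p1) v /\ qform (mu ^+ 2 *: H1) v <= qform H2 v.
  have [df1 [fd1 df10 dfd1]] := J1 (mu *: v).
  have [df2 [fd2 df20 dfd2]] := J2 v.
  have wd z : is_derive z (1:R) (fun z => u1 (mu *: y + z *: (mu *: v)) (mu ^+ 2 * s)
      - u2 (y + z *: v) s) (df1 z - df2 z).
    exact: is_deriveB (fd1 z) (fd2 z).
  have dwd : is_derive (0:R) (1:R) (fun z => df1 z - df2 z)
     (qform H1 (mu *: v) - qform H2 v) by exact: is_deriveB.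
  have mx z : u1 (mu *: y + z *: (mu *: v)) (mu ^+ 2 * s) - u2 (y + z *: v) s
     <= u1 (mu *: y) (mu ^+ 2 * s) - u2 y s.
    have := my (y + z *: v); rewrite -fy /f /=.
    rewrite scalerDr !scalerA (mulrC z); lra.
  split.
    have := derive_local_max0 wd; rewrite df10 df20 dotZl dotZr => h.
    suff : mu * dot p1 v - dot p2 v = 0 by lra.
    apply: h; exists 1 => //= z _; rewrite !scale0r !addr0; exact: mx.
  rewrite qformZ -qformZv -subr_le0.
  apply: (second_derivative_le0 wd dwd).
  exists 1 => //= z _; rewrite !scale0r !addr0.
  have := mx z; have := mx (- z); lra.
have pE : p2 = mu *: p1 by apply: dot_inj => v; rewrite (max_line v).1.
have time : 0 <= mu ^+ 2 * mcf_trace p1 H1 - mcf_trace p2 H2 - d.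
  have s0 : 0 < s by lra.
  apply: (@derive_past_max_ge0 _ (fun z => f (y, z)) s _ s0); last first.
    by move=> z zs; rewrite fy; apply: ms.
  have Dm : is_derive s (1:R) (fun z => mu ^+ 2 * z) (mu ^+ 2).
    rewrite -[X in is_derive _ _ _ X]mulr1.
    exact: (@is_deriveZ R R R id (mu ^+ 2) s 1 1 (is_derive_id _ _)).
  have Dd : is_derive s (1:R) (fun z => d * z) d.
    rewrite -[X in is_derive _ _ _ X]mulr1.
    exact: (@is_deriveZ R R R id d s 1 1 (is_derive_id _ _)).
  rewrite [mu ^+ 2 * _]mulrC.
  have D1' := is_derive1_comp D1 Dm.
  exact: (is_deriveB (is_deriveB D1' D2) Dd).
have flat : mcf_trace p1 H1 <= mcf_trace p2 H1.
  rewrite pE; apply: mcf_trace_flatten; first by lra.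
  exact: convex_jet_ge0 (u1_convex (mT _ sT)) J1.
have : mu ^+ 2 * mcf_trace p2 H1 <= mcf_trace p2 H2.
  by rewrite -mcf_traceZ; apply: mcf_trace_mono => v; exact: (max_line v).2.
have : mu ^+ 2 * mcf_trace p1 H1 <= mu ^+ 2 * mcf_trace p2 H1.
  by rewrite ler_pM2l //; lra.
lra.
Qed.

(** Let mu -> 1 in contracted_comparison.  The witness mu = 1 - h keeps u1 close
    to its value at (x, t) and makes the error (1 - mu) (u0(0) - m) less than
    half of the supposed gap. *)
Lemma mcf_le x t : 0 < t < T -> u1 x t <= u2 x t.
Proof.
move=> tT; rewrite leNgt; apply/negP => u12.
have [m mP] := proper_bounded_below u0_proper
  (fun r => initial_data_bounded u1_mcf u1_init r T0).
have C0 : 0 <= u0 0 - m by rewrite subr_ge0.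
pose g (mu : R) := u1 (mu *: x) (mu ^+ 2 * t).
have cg : {for (1:R), continuous g}.
  apply: (@continuous_comp _ _ _ (fun mu : R => (mu *: x, mu ^+ 2 * t))
     (fun p : 'rV[R]_n * R => u1 p.1 p.2)).
    apply: (@cvg_pair _ _ _ (nbhs (1:R)) (nbhs (1 *: x)) (nbhs (1 ^+ 2 * t))).
      by apply: cvgZl; exact: cvg_id.
    apply: cvgM; last exact: cvg_cst.
    exact: exprn_continuous.
  rewrite scale1r expr1n mul1r.
  exact: mcf_solution_continuous u1_mcf tT.
pose e := (u1 x t - u2 x t) / 2.
have e0 : 0 < e by rewrite /e; lra.
have : nbhs (1:R) [set mu | u2 x t + e < g mu].
  apply: (cg _ (open_nbhs_nbhs (conj (@open_gt _ _) _))).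
  by rewrite /= /g scale1r expr1n mul1r /e; lra.
move=> [r /= r0 H].
pose h := Num.min (r / 2) (Num.min (1 / 2) (e / (u0 0 - m + 1))).
have h0 : 0 < h.
  rewrite !lt_min; apply/and3P; split; [lra | lra | by rewrite divr_gt0 //; lra].
have hr : h <= r / 2 by rewrite /h ge_min lexx.
have h1 : h <= 1 / 2 by rewrite /h !ge_min lexx orbT.
have he : h <= e / (u0 0 - m + 1) by rewrite /h !ge_min lexx !orbT.
have := H (1 - h); rewrite /= opprB addrC subrK gtr0_norm // => /(_ ltac:(lra)).
have := @contracted_comparison (1 - h) x t m ltac:(lra) mP tT.
rewrite -/(g (1 - h)) subKr => k1 k2.
have : h * (u0 0 - m + 1) <= e by rewrite -ler_pdivlMr //; lra.
rewrite mulrDr mulr1; lra.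
Qed.

End Comparison.

Theorem theorem5p1 (R : realType) (n : nat) (hn : (1 <= n)%N)
    (T : R) (hT : 0 < T)
    (u0 : 'rV[R]_n -> R)
    (u0_convex : convex_entire_graph u0)
    (u0_proper : proper_entire_graph u0)
    (u1 u2 : 'rV[R]_n -> R -> R)
    (u1_mcf : smooth_graphical_mcf T u1)
    (u2_mcf : smooth_graphical_mcf T u2)
    (u1_proper : forall t : R, 0 < t < T -> proper_entire_graph (u1 ^~ t))
    (u2_proper : forall t : R, 0 < t < T -> proper_entire_graph (u2 ^~ t))
    (u1_convex : forall t : R, 0 < t < T -> convex_entire_graph (u1 ^~ t))
    (u2_convex : forall t : R, 0 < t < T -> convex_entire_graph (u2 ^~ t))
    (u1_init : has_initial_data u1 u0)
    (u2_init : has_initial_data u2 u0) :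
  (forall (x : 'rV[R]_n) (t : R), 0 < t < T -> u1 x t = u2 x t) /\
  (forall t : R, 0 < t < T -> graph (u1 ^~ t) = graph (u2 ^~ t)).
Proof.
have u12 x t : 0 < t < T -> u1 x t = u2 x t.
  by move=> tT; apply/eqP; rewrite eq_le !(@mcf_le _ _ T u0).
split=> // t tT; congr graph; apply/funext => x; exact: u12.
Qed.
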